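(* Let $\mathrm{deg}:\mathbb{Z}^n\to\mathbb{Z}^q$ be a positive grading of $\mathbb{K}[x_1,\dots,x_n]$ and let $h:\mathbb{Z}^q\to\mathbb{N}$ be any function. Then the multigraded Hilbert scheme $\mathrm{Hilb}_h$ has the induced subgraph property: whenever $M_1,M_2\in\mathrm{Hilb}_h$ are monomial ideals which are connected by an edge in the graph of monomial ideals $\mathcal{G}_{n,\mathbb{K}}$, they can also be connected via an edge ideal $I$ which lies in $\mathrm{Hilb}_h$, i.e. there is an edge ideal $I$ that is homogeneous with respect to $\mathrm{deg}$, has $\dim_{\mathbb{K}}(\mathbb{K}[\mathbf{x}]/I)_a=h(a)$ for all $a\in\mathbb{Z}^q$, and whose set of initial monomial ideals is $\{M_1,M_2\}$.
   Context: $\mathbb{K}$ is a field, $\mathbb{K}[\mathbf{x}]=\mathbb{K}[x_1,\dots,x_n]$, $\mathbb{N}=\{0,1,2,\dots\}$. A grading of $\mathbb{K}[\mathbf{x}]$ by an abelian group $A$ is given by an epimorphism $\mathrm{deg}:\mathbb{Z}^n\to A$, where $\mathbf{x}^u$ has degree $\mathrm{deg}(u)$; it is positive if only the constants have degree $0$, i.e. $\mathbb{N}^n\cap\ker(\mathrm{deg})=\{0\}$. For $h:A\to\mathbb{N}$, the multigraded Hilbert scheme $\mathrm{Hilb}_h$ parametrizes all $\mathrm{deg}$-homogeneous ideals $I\subseteq\mathbb{K}[\mathbf{x}]$ such that $\mathbb{K}[\mathbf{x}]/I$ has Hilbert function $h$, i.e. $\dim_{\mathbb{K}}(\mathbb{K}[\mathbf{x}]/I)_a=h(a)$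 for all $a\in A$. The graph of monomial ideals $\mathcal{G}_{n,\mathbb{K}}$ has as vertices all monomial ideals of $\mathbb{K}[\mathbf{x}]$; two distinct monomial ideals $M_1,M_2$ are connected by an edge if there exists an ideal $I\subseteq\mathbb{K}[\mathbf{x}]$ such that the set of all initial monomial ideals $\mathrm{in}_\prec(I)$, with $\prec$ ranging over all term orders, is precisely $\{M_1,M_2\}$. An ideal $I$ is an edge ideal if there exists $c\in\mathbb{Z}^n$ with both positive and negative coordinates such that $I$ is homogeneous with respect to the induced $(\mathbb{Z}^n/\mathbb{Z}c)$-grading of $\mathbb{K}[\mathbf{x}]$ (in which $\mathbf{x}^u$ has degree $u+\mathbb{Z}c$). *)

(* Defs.v *)
From HB Require Import structures.
From mathcomp Require Import all_boot all_order all_algebra.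
From mathcomp Require Export mpoly.

Set Implicit Arguments.
Unset Strict Implicit.
Unset Printing Implicit Defensive.

Import Order.TTheory GRing.Theory Num.Theory.
Local Open Scope ring_scope.

(* Ideals are Prop-valued subsets of {mpoly K[n]}.  The library predicate
   [idealr_closed] is not used because it excludes the unit ideal. *)

Definition psubset (K : fieldType) (n : nat) := {mpoly K[n]} -> Prop.

Definition same_set (K : fieldType) (n : nat) (I J : psubset K n) : Prop :=
  forall f, I f <-> J f.

Definition is_ideal (K : fieldType) (n : nat) (I : psubset K n) : Prop :=
  [/\ I 0,
      forall f g, I f -> I g -> I (f + g)
    & forall p f, I f -> I (p * f)].

Definition ideal_gen (K : fieldType) (n : nat) (S : psubset K n) :
    psubset K n :=
  fun f => forall J : psubset K n,
    is_ideal J -> (forall g, S g -> J g) -> J f.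

Definition monomials_of (K : fieldType) (n : nat) (S : 'X_{1..n} -> Prop) :
    psubset K n :=
  fun f => exists2 m, S m & f = 'X_[m].

Definition monomial_ideal (K : fieldType) (n : nat) (M : psubset K n) : Prop :=
  exists S : 'X_{1..n} -> Prop, same_set M (ideal_gen (monomials_of (K := K) S)).

(* [le] is the non-strict relation of the order. *)
Definition term_order (n : nat) (le : rel 'X_{1..n}) : Prop :=
  [/\ [/\ reflexive le, antisymmetric le, transitive le & total le],
      forall m, le 0%MM m
    & forall m1 m2 m, le m1 m2 -> le (m1 + m)%MM (m2 + m)%MM].

(* The zero polynomial has no initial monomial. *)
Definition is_initial_monomial (K : fieldType) (n : nat) (le : rel 'X_{1..n})
    (f : {mpoly K[n]}) (m : 'X_{1..n}) : Prop :=
  m \in msupp f /\ forall m', m' \in msupp f -> le m' m.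

Definition initial_ideal (K : fieldType) (n : nat) (le : rel 'X_{1..n})
    (I : psubset K n) : psubset K n :=
  ideal_gen (monomials_of (K := K)
    (fun m => exists2 f, I f & is_initial_monomial le f m)).

Definition initial_ideals_are (K : fieldType) (n : nat)
    (I M1 M2 : psubset K n) : Prop :=
  forall M : psubset K n,
    (exists2 le : rel 'X_{1..n}, term_order le & same_set M (initial_ideal le I))
    <-> (same_set M M1 \/ same_set M M2).

Definition graph_edge (K : fieldType) (n : nat) (M1 M2 : psubset K n) : Prop :=
  [/\ monomial_ideal M1, monomial_ideal M2, ~ same_set M1 M2
    & exists2 I : psubset K n, is_ideal I & initial_ideals_are I M1 M2].

Definition expv (n : nat) (m : 'X_{1..n}) : 'rV[int]_n :=
  \row_(i < n) (m i)%:Z.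

(* A grading enters homogeneity only through the relation "x^u and x^v have
   the same degree" on monomials; no quotient group needs to be built for the
   (Z^n/Zc)-grading. *)
Definition homogeneous (K : fieldType) (n : nat)
    (same_deg : 'X_{1..n} -> 'X_{1..n} -> Prop) (f : {mpoly K[n]}) : Prop :=
  forall u v, u \in msupp f -> v \in msupp f -> same_deg u v.

Definition homogeneous_ideal (K : fieldType) (n : nat)
    (same_deg : 'X_{1..n} -> 'X_{1..n} -> Prop) (I : psubset K n) : Prop :=
  is_ideal I /\
  same_set I (ideal_gen (fun f => I f /\ homogeneous same_deg f)).

Definition same_degree (n q : nat) (deg : 'rV[int]_n -> 'rV[int]_q)
    (u v : 'X_{1..n}) : Prop :=
  deg (expv u) = deg (expv v).

(* u + Zc = v + Zc *)
Definition same_coset (n : nat) (c : 'rV[int]_n) (u v : 'X_{1..n}) : Prop :=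
  exists k : int, expv u - expv v = k *: c.

Definition edge_ideal (K : fieldType) (n : nat) (I : psubset K n) : Prop :=
  exists c : 'rV[int]_n,
    [/\ exists i, 0 < c 0 i, exists j, c 0 j < 0
      & homogeneous_ideal (same_coset c) I].

Definition positive_grading (n q : nat) (deg : 'rV[int]_n -> 'rV[int]_q) :
    Prop :=
  forall u : 'X_{1..n}, deg (expv u) = 0 -> u = 0%MM.

Definition graded_piece (K : fieldType) (n q : nat)
    (deg : 'rV[int]_n -> 'rV[int]_q) (a : 'rV[int]_q) : psubset K n :=
  fun f => forall u, u \in msupp f -> deg (expv u) = a.

(* dim_K V / (V \cap W) = d, for linear subspaces V and W: some d elements of V
   form a basis modulo W. *)
Definition quotient_dim (K : fieldType) (n : nat) (V W : psubset K n)
    (d : nat) : Prop :=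
  exists b : 'I_d -> {mpoly K[n]},
    [/\ forall i, V (b i),
        forall x : 'I_d -> K, W (\sum_i x i *: b i) -> forall i, x i = 0
      & forall f, V f -> exists x : 'I_d -> K, W (f - \sum_i x i *: b i)].

(* The K-points of the multigraded Hilbert scheme; (K[x]/I)_a is the image of
   K[x]_a in K[x]/I. *)
Definition in_Hilb (K : fieldType) (n q : nat)
    (deg : 'rV[int]_n -> 'rV[int]_q) (h : 'rV[int]_q -> nat)
    (I : psubset K n) : Prop :=
  homogeneous_ideal (same_degree deg) I /\
  forall a, quotient_dim (@graded_piece K n q deg a) I (h a).

(* Main.v *)
Require Import Defs.
From HB Require Import structures.
From mathcomp Require Import all_boot all_order all_algebra.
From mathcomp Require Import mpoly.
From mathcomp Require boolp classical_sets.

Set Implicit Arguments.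
Unset Strict Implicit.
Unset Printing Implicit Defensive.

Import Order.TTheory GRing.Theory Num.Theory.
Local Open Scope ring_scope.

(** Let I realise the edge, let le1 and le2 be term orders with initial ideals
    M1 and M2, and let S1 and S2 be the sets of monomials of M1 and M2.

    The wall.  A term order le is determined by the cone of integer vectors it
    makes nonnegative ([nonneg_in]), and conversely every pointed additive cone
    containing the orthant extends to a term order ([cone_extends_to_order]).
    The set of vectors that are nonnegative for every order with initial ideal
    Mi is the dual of the i-th cone of the Groebner fan ([groebner_dual]); it
    contains a - b whenever b occurs in the normal form of a monomial a of Mi,
    and these differences alone force the initial ideal to be Mi.  If the sum
    of the two dual cones were pointed, one order would have both initial
    ideals.  Hence there is a nonzero c with c in the first dual cone and - c
    in the second ([wall_exists]).  As every order has initial ideal M1 or M2,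
    the sign of c decides which one it is, so the first dual cone is generated,
    up to positive multiples, by c and the orthant ([dual1_halfspace]).  Neither
    c nor - c lies in the orthant, so c has coordinates of both signs and some
    strictly positive weight w is orthogonal to it.

    The edge ideal.  Take J to be the ideal of w-initial forms of I.  Its
    initial ideal for le is that of I for the refinement of w by le, so it is
    M1 or M2; refining does not change the sign of c, so both still occur.  In
    a - (normal form of a) every monomial has weight at most that of a, with
    equality only on a + Zc once c is primitive.  So J is spanned by elements
    that are homogeneous modulo c ([edge_ideal_exists]).

    The Hilbert function.  If deg c = 0, then J is deg-homogeneous and, by
    Groebner theory, has the Hilbert function of M1 ([quotient_dim_initial]).
    If deg c <> 0, positivity of the grading bounds the degrees of monomials on
    all lines a + Z (deg c) on the same side ([bounded_below_or]), say below.
    In the lowest degree on such a line in which S1 and S2 differ, a monomial of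
    S1 minus its normal form modulo J has, within its coset of Zc, all its other
    terms in lower degrees, where standard means the same for both orders; so
    the monomial has to lie in S2.
    Equality of the Hilbert functions of M1 and M2 then turns the inclusion of
    S1 in S2 in this degree into an equality, a contradiction
    ([hilbert_rigid]). *)

(** * Dickson's lemma *)

(** Induction on the number of coordinates.  A finite basis B0 for the first n
    coordinates, taken inside S, already dominates every element whose last
    coordinate is at least the maximum over B0; below that maximum there are only
    finitely many slices on which the last coordinate is constant, and on each
    of them the first n coordinates suffice. *)
Lemma dickson (T : eqType) (f : nat -> T -> nat) (n : nat) (S : T -> Prop) :
  exists B : seq T, (forall b, b \in B -> S b) /\
    forall s, S s -> exists2 b, b \in B &
      forall i, (i < n)%N -> (f i b <= f i s)%N.
Proof.
elim: n S => [|n IH] S.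
  have [[s Ss]|noS] := boolp.pselect (exists s, S s).
    exists [:: s]; split=> [b|t _]; first by rewrite inE => /eqP ->.
    by exists s; rewrite ?inE.
  by exists [::]; split=> // s Ss; case: noS; exists s.
have [B0 [B0S B0le]] := IH S.
have slices K : exists B : seq T, (forall b, b \in B -> S b) /\
    forall s, S s -> (f n s < K)%N -> exists2 b, b \in B &
      forall i, (i < n.+1)%N -> (f i b <= f i s)%N.
  elim: K => [|K [B [BS Ble]]]; first by exists [::].
  have [C [CS Cle]] := IH (fun s => S s /\ f n s = K).
  exists (B ++ C); split=> [b|s Ss].
    by rewrite mem_cat => /orP[/BS|/CS[]].
  rewrite ltnS leq_eqVlt => /orP[/eqP fs|/(Ble s Ss)[b bB ble]]; last first.
    by exists b; rewrite ?mem_cat ?bB.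
  have [b bC ble] := Cle s (conj Ss fs).
  exists b; first by rewrite mem_cat bC orbT.
  move=> i; rewrite ltnS leq_eqVlt => /orP[/eqP ->|/ble //].
  by have [_ ->] := CS b bC; rewrite fs.
have [C [CS Cle]] := slices (\max_(b <- B0) f n b)%N.
exists (B0 ++ C); split=> [b|s Ss].
  by rewrite mem_cat => /orP[/B0S|/CS].
have [lt_s|le_s] := ltnP (f n s) (\max_(b <- B0) f n b)%N.
  have [b bC ble] := Cle s Ss lt_s.
  by exists b; rewrite ?mem_cat ?bC ?orbT.
have [b bB ble] := B0le s Ss.
exists b; first by rewrite mem_cat bB.
move=> i; rewrite ltnS leq_eqVlt => /orP[/eqP ->|/ble //].
by apply: leq_trans le_s; rewrite (big_rem b) //= leq_maxl.
Qed.

Lemma dickson_mnm (n : nat) (S : 'X_{1..n} -> Prop) :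
  exists B : seq 'X_{1..n}, (forall b, b \in B -> S b) /\
    forall s, S s -> exists2 b, b \in B & (b <= s)%MM.
Proof.
have [B [BS Ble]] := dickson (fun i (m : 'X_{1..n}) => nth 0%N m i) n S.
exists B; split=> // s /Ble[b bB ble]; exists b => //.
by apply/mnm_lepP => i; rewrite !(mnm_nth 0%N) ble.
Qed.

(** * Term orders as cones in the exponent lattice *)

Section ExponentVectors.
Variable n : nat.
Implicit Types (u v m : 'X_{1..n}) (z : 'rV[int]_n).

Lemma expv0 : expv (0%MM : 'X_{1..n}) = 0.
Proof. by apply/rowP => i; rewrite !mxE mnm0E. Qed.

Lemma expvD u v : expv (u + v)%MM = expv u + expv v.
Proof. by apply/rowP => i; rewrite !mxE mnmDE PoszD. Qed.

Lemma expvMn u k : expv (u *+ k)%MM = expv u *+ k.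
Proof.
elim: k => [|k IH]; first by rewrite mulm0n expv0.
by rewrite mulmS expvD IH mulrS.
Qed.

Lemma expv_inj : injective (@expv n).
Proof.
move=> u v /rowP uv; apply/mnmP => i.
by have := uv i; rewrite !mxE => -[].
Qed.

Lemma expv_subE z : exists u v, expv u - expv v = z.
Proof.
exists [multinom if (0 <= z 0 i)%R then absz (z 0%R i) else 0%N | i < n].
exists [multinom if (0 <= z 0 i)%R then 0%N else absz (z 0%R i) | i < n].
apply/rowP => i; rewrite !mxE !mnmE; case: ifP => z0.
  by rewrite subr0 gez0_abs.
by rewrite sub0r ltz0_abs ?opprK // ltNge z0.
Qed.

Lemma expv_ge0 z : (forall i, 0 <= z 0 i) -> exists u, expv u = z.
Proof.
move=> z0; exists [multinom absz (z 0%R i) | i < n].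
by apply/rowP => i; rewrite !mxE mnmE gez0_abs.
Qed.

Lemma rowMn_eq0 z k :
  (0 < k)%N -> z *+ k = 0 -> z = 0.
Proof.
move=> k0 /rowP zk; apply/rowP => i; move/eqP: (zk i).
by rewrite mulmxnE !mxE mulrn_eq0 eqn0Ngt k0 => /eqP ->.
Qed.

End ExponentVectors.

(** The cone of the term order extended to the group of integer vectors; by
    [nonneg_inB] the choice of the representatives u and v is immaterial. *)
Definition nonneg_in (n : nat) (le : rel 'X_{1..n}) (z : 'rV[int]_n) : Prop :=
  exists u v, expv u - expv v = z /\ le v u.

Section NonnegIn.
Variables (n : nat) (le : rel 'X_{1..n}).
Hypothesis le_order : term_order le.
Implicit Types (u v m : 'X_{1..n}) (y z : 'rV[int]_n).
Local Notation pos := (nonneg_in le).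

(** Two representations of the same difference differ by translations, and a
    term order can be tested after any translation: it is total, so it also
    reflects comparisons. *)
Lemma nonneg_inB u v : pos (expv u - expv v) <-> le v u.
Proof.
case: le_order => [[lexx le_anti le_trans le_total] le0 leD].
split=> [[u' [v' [eq_uv le_uv]]]|]; last by exists u, v.
have {}eq_uv : (u' + v = u + v')%MM.
  apply: expv_inj; rewrite !expvD.
  by apply/eqP; move/eqP: eq_uv; rewrite subr_eq addrAC eq_sym subr_eq eq_sym.
have := leD _ _ v le_uv; rewrite eq_uv => le_m.
case/orP: (le_total v u) => // /(leD _ _ v');
  rewrite [(v' + v)%MM]addmC in le_m *.
move=> le_m'; have /addIm-> // : (v + v' = u + v')%MM.
by apply: le_anti; rewrite le_m.
Qed.

Lemma nonneg_in_expv u : pos (expv u).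
Proof.
have [_ le0 _] := le_order.
by exists u, 0%MM; rewrite expv0 subr0; split.
Qed.

Lemma nonneg_in0 : pos 0.
Proof. by rewrite -(@expv0 n); apply: nonneg_in_expv. Qed.

Lemma nonneg_inD y z : pos y -> pos z -> pos (y + z).
Proof.
case: le_order => [[lexx le_anti le_trans le_total] le0 leD].
move=> [u [v [<- le_uv]]] [u' [v' [<- le_uv']]].
exists (u + u')%MM, (v + v')%MM; split.
  by rewrite !expvD opprD addrACA.
by apply: le_trans (leD _ _ v' le_uv) _; rewrite ![(u + _)%MM]addmC leD.
Qed.

Lemma nonneg_inMn z k : pos z -> pos (z *+ k).
Proof.
move=> pos_z; elim: k => [|k IH]; first exact: nonneg_in0.
by rewrite mulrS; apply: nonneg_inD.
Qed.

Lemma nonneg_in_anti z : pos z -> pos (- z) -> z = 0.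
Proof.
case: le_order => [[lexx le_anti le_trans le_total] le0 leD].
have [u [v <-]] := expv_subE z; rewrite opprB => /nonneg_inB uv /nonneg_inB vu.
by rewrite (le_anti u v) ?subrr // vu.
Qed.

Lemma nonneg_in_total z : pos z \/ pos (- z).
Proof.
case: le_order => [[lexx le_anti le_trans le_total] le0 leD].
have [u [v <-]] := expv_subE z; rewrite opprB.
by have /orP[/nonneg_inB|/nonneg_inB] := le_total v u; [left | right].
Qed.

Lemma nonneg_inMn_cancel z k : (0 < k)%N -> pos (z *+ k) -> pos z.
Proof.
move=> k0 pos_zk; have [//|pos_Nz] := nonneg_in_total z.
have /(rowMn_eq0 k0) -> : z *+ k = 0; last exact: nonneg_in0.
by apply: nonneg_in_anti; rewrite // -mulNrn; apply: nonneg_inMn.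
Qed.

End NonnegIn.

Definition pointed_cone (n : nat) (P : 'rV[int]_n -> Prop) : Prop :=
  [/\ P 0, forall y z, P y -> P z -> P (y + z)
    & forall z, P z -> P (- z) -> z = 0].

(** By Zorn's lemma: a failure of pointedness involves two vectors, so it already
    occurs in a member of the chain. *)
Lemma pointed_cone_maximal (n : nat) (P : 'rV[int]_n -> Prop) :
  pointed_cone P -> exists Q : 'rV[int]_n -> Prop,
    [/\ pointed_cone Q, forall z, P z -> Q z
      & forall Q', pointed_cone Q' -> (forall z, Q z -> Q' z) ->
          forall z, Q' z -> Q z].
Proof.
move=> [P0 PD Panti].
(* Allowing the empty set makes the empty chain have its union as a bound. *)
pose good (A : classical_sets.set 'rV[int]_n) :=
  [/\ forall y z, A y -> A z -> A (y + z),
      forall z, A z -> A (- z) -> z = 0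
    & forall z y, A z -> P y -> A y].
have good_P : good P by split.
have [|Q [[QD Qanti QP] Qmax]] := @classical_sets.Zorn_bigcup _ good.
  move=> F Fgood Ftot.
  have common A B : F A -> F B -> exists C, [/\ F C, forall z, A z -> C z
      & forall z, B z -> C z].
    by move=> FA FB; case: (Ftot A B FA FB) => sub; [exists B | exists A].
  split.
  - move=> y z [A FA Ay] [B FB Bz].
    have [C [FC AC BC]] := common A B FA FB.
    have [CD _ _] := Fgood C FC.
    by exists C => //; apply: CD; [apply: AC | apply: BC].
  - move=> z [A FA Az] [B FB Bz].
    have [C [FC AC BC]] := common A B FA FB.
    have [_ Canti _] := Fgood C FC.
    by apply: Canti; [apply: AC | apply: BC].
  - move=> z y [A FA Az] Py; exists A => //.
    by have [_ _ AP] := Fgood A FA; apply: AP Az Py.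
have [z0 Qz0] : exists z0, Q z0.
  apply: boolp.contrapT => noQ; apply: (Qmax P) => //; split.
    by move=> z Qz; case: noQ; exists z.
  by move=> sub; apply: noQ; exists 0; apply: sub.
have PQ z : P z -> Q z by move=> Pz; apply: QP Qz0 Pz.
exists Q; split=> //; first by split=> //; apply: PQ.
move=> Q' [Q'0 Q'D Q'anti] QQ' z Q'z; apply: boolp.contrapT => nQz.
apply: (Qmax Q'); last first.
  by split=> // y x Q'y Px; apply/QQ'/PQ.
by split=> // sub; apply: nQz; apply: sub.
Qed.

(** A maximal pointed cone Q is total, as in the extension of partial orders
    of torsion-free groups: if z is not in Q, adjoining z destroys pointedness,
    which puts a negative multiple of z in Q; if - z is not in Q either, a
    positive multiple of z is in Q as well, and z = 0. *)
Lemma cone_extends_to_order (n : nat) (P : 'rV[int]_n -> Prop) :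
  pointed_cone P -> (forall u, P (expv u)) ->
  exists2 le, term_order le & forall z, P z -> nonneg_in le z.
Proof.
move=> coneP Pexpv.
have [Q [[Q0 QD Qanti] PQ Qmax]] := pointed_cone_maximal coneP.
have QMn z k : Q z -> Q (z *+ k).
  by move=> Qz; elim: k => [//|k IH]; rewrite mulrS; apply: QD.
have adjoin z : ~ Q z -> exists2 k, (0 < k)%N & Q (- (z *+ k)).
  move=> nQz; apply: boolp.contrapT => noK.
  pose Q' y := exists2 p, Q p & exists k, y = p + z *+ k.
  apply/nQz/(Qmax Q'); last by exists 0; last by exists 1; rewrite add0r.
  - split.
    + by exists 0; last by exists 0; rewrite add0r.
    + move=> _ _ [p Qp [k ->]] [p' Qp' [k' ->]]; exists (p + p');
        first exact: QD.
      by exists (k + k')%N; rewrite mulrnDr addrACA.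
    + move=> y [p Qp [k yE]] [p' Qp' [k' NyE]].
      have sum0 : p + p' = - (z *+ (k + k')).
        apply/eqP; rewrite -addr_eq0 mulrnDr addrACA -yE -NyE subrr //.
      have [kk0|kk0] := posnP (k + k'); last first.
        by case: noK; exists (k + k')%N; rewrite // -sum0; apply: QD.
      move/eqP: kk0; rewrite addn_eq0 => /andP[/eqP k0 /eqP k'0].
      move: yE NyE; rewrite k0 k'0 !mulr0n !addr0 => yE NyE.
      by apply: Qanti; rewrite ?NyE ?yE.
  - by move=> p Qp; exists p => //; exists 0; rewrite addr0.
have Qtotal z : Q z \/ Q (- z).
  have [|nQz] := boolp.EM (Q z); first by left.
  have [|nQNz] := boolp.EM (Q (- z)); first by right.
  have [k k0 Qk] := adjoin z nQz; have [l l0 Ql] := adjoin _ nQNz.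
  have zkl : z *+ (k * l) = 0.
    apply: Qanti; last by rewrite mulrnA -mulNrn; apply: QMn.
    by rewrite mulnC mulrnA; apply: QMn; move: Ql; rewrite mulNrn opprK.
  by case: nQz; rewrite (rowMn_eq0 _ zkl) // muln_gt0 k0.
pose le (a b : 'X_{1..n}) := boolp.asbool (Q (expv b - expv a)).
have leP a b : reflect (Q (expv b - expv a)) (le a b) by apply: boolp.asboolP.
exists le; last first.
  move=> z /PQ Qz; have [u [v zE]] := expv_subE z.
  by exists u, v; split=> //; apply/leP; rewrite zE.
split; first split.
- by move=> a; apply/leP; rewrite subrr.
- move=> a b /andP[/leP ab /leP ba]; apply/esym/expv_inj/eqP; rewrite -subr_eq0.
  by apply/eqP/Qanti; rewrite ?opprB.
- move=> b a d /leP ab /leP bd; apply/leP.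
  by have := QD _ _ bd ab; rewrite addrA subrK.
- move=> a b; apply/orP.
  have [Qab|Qba] := Qtotal (expv b - expv a); [left | right]; apply/leP => //.
  by move: Qba; rewrite opprB.
- by move=> m; apply/leP; rewrite expv0 subr0; apply/PQ/Pexpv.
- move=> a b m /leP Qab; apply/leP.
  by rewrite !expvD opprD addrACA subrr addr0.
Qed.

(** * Ideals and their initial monomials *)

Section Restriction.
Variables (K : fieldType) (n : nat).
Implicit Types (f g : {mpoly K[n]}) (P : pred 'X_{1..n}).

(** The part of f on the monomials in P; with suitable P this yields standard
    parts and the components of f for the gradings that occur. *)
Definition mrestr P f : {mpoly K[n]} :=
  \sum_(m <- msupp f | P m) f@_m *: 'X_[m].

Lemma mcoeff_mrestr P f m : (mrestr P f)@_m = if P m then f@_m else 0.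
Proof.
rewrite /mrestr raddf_sum /=.
under eq_bigr do rewrite mcoeffZ mcoeffX.
have [m_f|m_f] := boolP (m \in msupp f); last first.
  rewrite (memN_msupp_eq0 m_f) if_same big_seq_cond big1 // => m' /andP[m'f _].
  by case: eqP m_f m'f => [-> /negP|_ _ _] //; rewrite mulr0.
rewrite big_mkcond (bigD1_seq m) ?msupp_uniq //= eqxx mulr1 big1 ?addr0 //.
by move=> m' /negPf m'm; rewrite m'm mulr0 if_same.
Qed.

Lemma msupp_mrestr P f m : (m \in msupp (mrestr P f)) = P m && (m \in msupp f).
Proof. by rewrite !mcoeff_msupp mcoeff_mrestr; case: (P m); rewrite ?eqxx. Qed.

Lemma mrestr_is_linear P : linear (mrestr P).
Proof.
move=> a f g; apply/mpolyP => m; rewrite mcoeffD mcoeffZ !mcoeff_mrestr.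
by case: (P m); rewrite ?mcoeffD ?mcoeffZ // mulr0 addr0.
Qed.
HB.instance Definition _ P :=
  GRing.isLinear.Build K {mpoly K[n]} {mpoly K[n]} _ (mrestr P)
    (mrestr_is_linear P).

End Restriction.

Section Ideals.
Variables (K : fieldType) (n : nat).
Implicit Types (I J : psubset K n) (f g : {mpoly K[n]}) (m u v : 'X_{1..n}).

(** The K-subspaces, since ideals, monomial ideals and graded pieces all occur
    as such in the dimension counts. *)
Definition submodule I : Prop :=
  [/\ I 0, forall f g, I f -> I g -> I (f + g)
    & forall (a : K) f, I f -> I (a *: f)].

Lemma ideal_submodule I : is_ideal I -> submodule I.
Proof.
by case=> I0 ID IM; split=> // a f If; rewrite -mul_mpolyC; apply: IM.
Qed.

Lemma submodule_sum I (T : eqType) (r : seq T) (P : pred T) F :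
  submodule I -> (forall i, i \in r -> P i -> I (F i)) ->
    I (\sum_(i <- r | P i) F i).
Proof.
move=> [I0 ID _] IF; rewrite big_seq_cond.
by apply: big_ind => // i /andP[]; apply: IF.
Qed.

Lemma submoduleB I f g : submodule I -> I f -> I g -> I (f - g).
Proof.
by case=> _ ID IZ If Ig; apply: ID => //; rewrite -scaleN1r; apply: IZ.
Qed.

Lemma submodule_lincomb I (T : eqType) (r : seq T) (x : T -> K) F :
  submodule I -> (forall i, I (F i)) -> I (\sum_(i <- r) x i *: F i).
Proof.
by move=> subI IF; apply: submodule_sum => // i _ _; case: subI => _ _; apply.
Qed.

Lemma ideal_gen_ideal (S : psubset K n) : is_ideal (ideal_gen S).
Proof.
split=> [J [] //|f g Sf Sg J idJ SJ|p f Sf J idJ SJ].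
  by case: (idJ) => _ JD _; apply: JD; [apply: Sf | apply: Sg].
by case: (idJ) => _ _; apply; apply: Sf.
Qed.

Lemma ideal_gen_sub (S : psubset K n) f : S f -> ideal_gen S f.
Proof. by move=> Sf J _; apply. Qed.

End Ideals.

Definition lead_mnm (K : fieldType) (n : nat) (le : rel 'X_{1..n})
    (I : psubset K n) (m : 'X_{1..n}) : Prop :=
  exists2 f, I f & is_initial_monomial le f m.

Lemma seq_min (T : eqType) (r : T -> T -> Prop) (s : seq T) : s != [::] ->
  (forall x y z, r x y -> r y z -> r x z) ->
  (forall x y, x \in s -> y \in s -> r x y \/ r y x) ->
  exists2 x, x \in s & forall y, y \in s -> r x y.
Proof.
move=> s_neq0 r_trans; elim: s s_neq0 => [//|x [|y s] IH] _ r_total.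
  exists x; first exact: mem_head.
  move=> y; rewrite inE => /eqP ->.
  by case: (r_total x x (mem_head _ _) (mem_head _ _)).
have [//|u v us vs|m ms m_min] := IH.
  by apply: r_total; rewrite inE ?us ?vs orbT.
have m_xs : m \in [:: x, y & s] by rewrite inE ms orbT.
have [xm|mx] := r_total x m (mem_head _ _) m_xs.
  exists x; first exact: mem_head.
  move=> z; rewrite inE => /predU1P[->|/m_min mz]; last exact: r_trans mz.
  by case: (r_total x x (mem_head _ _) (mem_head _ _)).
by exists m => // z; rewrite inE => /predU1P[->|/m_min].
Qed.

Section InitialMonomials.
Variables (K : fieldType) (n : nat) (le : rel 'X_{1..n}).
Hypothesis le_order : term_order le.
Implicit Types (I J : psubset K n) (f g : {mpoly K[n]}) (m u v : 'X_{1..n}).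

(** A Dickson basis of S is finite, so it has a least element; every element of
    S is above some basis element for divisibility, hence for the term order. *)
Lemma term_order_min (S : 'X_{1..n} -> Prop) :
  (exists m, S m) -> exists2 m, S m & forall m', S m' -> le m m'.
Proof.
case: le_order => [[lexx le_anti le_trans le_total] le0 leD].
have [B [BS Ble]] := dickson_mnm S.
move=> [s Ss]; have [b0 b0B _] := Ble s Ss.
have [|||m mB lem] := @seq_min _ le B; first by case: (B) b0B.
- by move=> x y z; apply: le_trans.
- by move=> x y _ _; case/orP: (le_total x y); [left | right].
exists m; first exact: BS.
move=> m' /Ble[b /lem le_mb /submK <-]; apply: le_trans le_mb _.
by have := leD _ _ b (le0 (m' - b)%MM); rewrite add0m.
Qed.

Lemma initial_monomial_exists f : f != 0 ->
  exists m, is_initial_monomial le f m.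
Proof.
case: le_order => [[lexx le_anti le_trans le_total] le0 leD].
rewrite -msupp_eq0 => f_neq0.
have [||m mf lem] := seq_min (r := fun x y => le y x) f_neq0; last by exists m.
- by move=> x y z yx zy; apply: le_trans yx.
- by move=> x y _ _; case/orP: (le_total y x); [left | right].
Qed.

Lemma lead_mnmD I m m' : is_ideal I -> lead_mnm le I m ->
  lead_mnm le I (m + m')%MM.
Proof.
case: le_order => [[lexx le_anti le_trans le_total] le0 leD].
move=> [_ _ IM] [f If [mf lem]]; exists ('X_[m'] * f); first exact: IM.
rewrite mulrC; split;
  first by rewrite mcoeff_msupp [(m + _)%MM]addmC mcoeffMX -mcoeff_msupp.
move=> u; rewrite (perm_mem (msuppMX _ _)) => /mapP[v /lem vm ->].
by rewrite [(m' + v)%MM]addmC leD.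
Qed.

(** The set of initial monomials of an ideal is closed under multiplication by
    monomials, so the polynomials supported on it already form an ideal. *)
Lemma initial_idealP I f : is_ideal I ->
  (initial_ideal le I f <-> forall m, m \in msupp f -> lead_mnm le I m).
Proof.
move=> idI; split.
- move=> genf.
  apply: (genf (fun g => forall m, m \in msupp g -> lead_mnm le I m));
    last first.
    by move=> _ [m lead_m ->] m' /mem_msuppXP <-.
  split=> [m|g h gl hl m|p g gl m].
  + by rewrite mcoeff_msupp mcoeff0 eqxx.
  + by move/msuppD_le; rewrite mem_cat => /orP[/gl|/hl].
  + move/msuppM_le => /allpairsP[[u v] /= [_ /gl lead_v ->]].
    by rewrite addmC; apply: lead_mnmD.
- move=> fl; rewrite [f]mpolyE.
  have [_ _ genZ] := ideal_submodule (ideal_gen_ideal (monomials_of (K :=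
    K) (lead_mnm le I))).
  apply: submodule_sum; first exact/ideal_submodule/ideal_gen_ideal.
  move=> m /fl lead_m _; apply: genZ; apply: ideal_gen_sub.
  by exists m.
Qed.

Lemma initial_idealX I m : is_ideal I ->
  (initial_ideal le I 'X_[m] <-> lead_mnm le I m).
Proof.
move=> idI; rewrite initial_idealP //; split; first by apply;
  rewrite msuppX inE.
by move=> lead_m m' /mem_msuppXP <-.
Qed.

(** Standard monomials are independent modulo I: the initial monomial of a
    nonzero element of I is not standard. *)
Lemma standard_eq0 I f :
  I f -> (forall m, m \in msupp f -> ~ lead_mnm le I m) -> f = 0.
Proof.
move=> If nlead; apply/eqP/contraT => /initial_monomial_exists[m init_m].
by case: (nlead m) => //; [case: init_m | exists f].
Qed.

(** Division with remainder.  By linearity it suffices to reduce monomials; the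
    least irreducible one would be initial for some g in I, and subtracting a
    multiple of g leaves only smaller, reducible monomials. *)
Lemma normal_form_exists I f : is_ideal I ->
  exists2 g, I (f - g) & forall m, m \in msupp g -> ~ lead_mnm le I m.
Proof.
move=> idI; have subI := ideal_submodule idI; case: (subI) => I0 ID IZ.
pose reducible f :=
  exists2 g, I (f - g) & forall m, m \in msupp g -> ~ lead_mnm le I m.
have subr : submodule reducible.
  split.
  - by exists 0 => [|m]; rewrite ?subrr // mcoeff_msupp mcoeff0 eqxx.
  - move=> p q [p' pp' sp'] [q' qq' sq']; exists (p' + q').
      by rewrite opprD addrACA; apply: ID.
    by move=> m /msuppD_le; rewrite mem_cat => /orP[/sp'|/sq'].
  - move=> a p [p' pp' sp']; exists (a *: p'); first by rewrite -scalerBr;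
      apply: IZ.
    by move=> m /msuppZ_le /sp'.
suff redX m : reducible 'X_[m].
  rewrite [f]mpolyE; apply: (submodule_sum subr) => m _ _.
  by case: subr => _ _; apply.
apply: boolp.contrapT => nred.
have [{nred}m nred m_min] :=
  term_order_min (ex_intro (fun m => ~ reducible 'X_[m]) m nred).
have [lead_m|nlead_m] := boolp.EM (lead_mnm le I m); last first.
  apply: nred; exists 'X_[m]; first by rewrite subrr.
  by move=> m' /mem_msuppXP <-.
have [g Ig [mg g_le]] := lead_m.
rewrite mcoeff_msupp in mg.
pose r := 'X_[m] - (g@_m)^-1 *: g.
have red_r : reducible r.
  rewrite [r]mpolyE; apply: (submodule_sum subr) => u ur _.
  case: (subr) => _ _; apply; apply: boolp.contrapT => /m_min le_mu.
  case: le_order => [[_ le_anti _ _] _ _].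
  have um : u != m.
    apply: contraTneq ur => ->.
    by rewrite mcoeff_msupp negbK mcoeffB mcoeffX eqxx mcoeffZ mulVf ?subrr.
  have : u \in msupp g.
    move: ur; rewrite !mcoeff_msupp mcoeffB mcoeffX [m == u]eq_sym (negPf um)
      sub0r mcoeffZ.
    by rewrite oppr_eq0 mulf_eq0 negb_or => /andP[].
  move=> /g_le le_um; move/eqP: um; apply; apply: le_anti.
  by rewrite le_um.
have [r' Ir' sr'] := red_r.
apply: nred; exists r' => //.
have -> : 'X_[m] - r' = (r - r') + (g@_m)^-1 *: g by rewrite addrAC subrK.
by apply: ID => //; apply: IZ.
Qed.

End InitialMonomials.

Lemma initial_ideal_lead (K : fieldType) (n : nat) le (I M : psubset K n) :
  term_order le -> is_ideal I -> same_set M (initial_ideal le I) ->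
  forall f, M f <-> forall m, m \in msupp f -> lead_mnm le I m.
Proof. by move=> ord idI ML f; rewrite ML; apply: initial_idealP. Qed.

Lemma lead_same_initial (K : fieldType) (n : nat) le le' (I J : psubset K n) :
  term_order le -> term_order le' -> is_ideal I -> is_ideal J ->
  (forall m, lead_mnm le I m <-> lead_mnm le' J m) ->
  same_set (initial_ideal le I) (initial_ideal le' J).
Proof.
move=> ord ord' idI idJ lead f; rewrite !initial_idealP //.
by split=> lf m /lf /lead.
Qed.

(** * The wall between the two initial ideals *)

Section Weight.
Variables (n : nat) (w : 'I_n -> nat).

Definition weight (z : 'rV[int]_n) : int := \sum_i (w i)%:Z * z 0 i.

Lemma weight_is_additive : zmod_morphism weight.
Proof.
move=> y z; rewrite /weight -sumrB; apply: eq_bigr => i _.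
by rewrite !mxE mulrBr.
Qed.
HB.instance Definition _ :=
  GRing.isZmodMorphism.Build 'rV[int]_n int weight weight_is_additive.

Lemma weight_expv_ge0 u : 0 <= weight (expv u).
Proof. by apply: sumr_ge0 => i _; rewrite !mxE mulr_ge0. Qed.

Lemma weight_expv_eq0 u : (forall i, 0 < w i)%N -> weight (expv u) = 0 ->
  u = 0%MM.
Proof.
move=> w0 /eqP; rewrite psumr_eq0 => [/allP wu|i _];
  last by rewrite !mxE mulr_ge0.
apply/mnmP => i; rewrite mnm0E; have := wu i (mem_index_enum i).
by rewrite !mxE mulf_eq0 !eqz_nat eqn0Ngt w0 /= => /eqP.
Qed.

End Weight.

(** With p the sum of the positive coordinates of c and - q that of the
    negative ones, the weight q on the former and p on the latter balances
    them: q * p - p * q = 0. *)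
Lemma orthogonal_weight_exists (n : nat) (c : 'rV[int]_n) :
  (exists i, 0 < c 0 i) -> (exists j, c 0 j < 0) ->
  exists2 w : 'I_n -> nat, (forall i, 0 < w i)%N & weight w c = 0.
Proof.
move=> [i ci] [j cj].
pose p := (\sum_(i | (0 < c 0%R i)%R) absz (c 0%R i))%N.
pose q := (\sum_(i | (c 0%R i < 0)%R) absz (c 0%R i))%N.
have p0 : (0 < p)%N by rewrite /p (bigD1 i) //= addn_gt0 absz_gt0 gt_eqF.
have q0 : (0 < q)%N by rewrite /q (bigD1 j) //= addn_gt0 absz_gt0 lt_eqF.
exists (fun k => if 0 < c 0 k then q else if c 0 k < 0 then p else 1%N).
  by move=> k; do 2?case: ifP.
have pE : p%:Z = \sum_(k | 0 < c 0 k) c 0 k.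
  by rewrite /p (big_morph Posz PoszD (erefl _)); apply: eq_bigr => k /gtz0_abs.
have qE : q%:Z = - \sum_(k | c 0 k < 0) c 0 k.
  rewrite /q (big_morph Posz PoszD (erefl _)) -sumrN.
  by apply: eq_bigr => k /ltz0_abs.
rewrite /weight (bigID (fun k => 0 < c 0 k)) /=.
under eq_bigr => k ck do rewrite ck.
rewrite -mulr_sumr -pE (bigID (fun k =>
  c 0 k < 0)) /= [X in _ + (_ + X)]big1 ?addr0.
  rewrite (eq_big (fun k => c 0 k < 0) (fun k => p%:Z * c 0 k)).
  - have -> : \sum_(k | c 0 k < 0) p%:Z * c 0 k = - (q%:Z * p%:Z).
      by rewrite -mulr_sumr qE mulNr opprK mulrC.
    by rewrite subrr.
  - by move=> k; case: ltgtP.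
  - by move=> k /andP[/negPf -> ->].
move=> k; rewrite -!leNgt => /andP[ck kc].
by rewrite (le_anti (introT andP (conj ck kc))) mulr0.
Qed.

Definition same_lead (K : fieldType) (n : nat) (I : psubset K n)
    (le le' : rel 'X_{1..n}) : Prop :=
  forall m, lead_mnm le I m <-> lead_mnm le' I m.

(** The standard monomials of either order form a basis modulo I, so strict
    inclusion is impossible: a monomial standard for le but not for le' would
    equal its own normal form for le'. *)
Lemma same_lead_sub (K : fieldType) (n : nat) (I : psubset K n) le le' :
  is_ideal I -> term_order le -> term_order le' ->
  (forall m, lead_mnm le I m -> lead_mnm le' I m) -> same_lead I le le'.
Proof.
move=> idI ord ord' sub m; split=> [/sub //|lead_m];
  apply: boolp.contrapT => nlead_m.
have [g Ig sg] := normal_form_exists ord' 'X_[m] idI.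
have /subr0_eq gm : 'X_[m] - g = 0.
  apply: (standard_eq0 ord Ig) => u /msuppB_le; rewrite mem_cat.
  by move=> /orP[/mem_msuppXP <- //|/sg nlead_u /sub].
by apply: (sg m) => //; rewrite -gm msuppX inE.
Qed.

(** The dual of the cone of the Groebner fan that le0 belongs to, where all term
    orders, rather than only weight vectors, are the points of the fan. *)
Definition groebner_dual (K : fieldType) (n : nat) (I : psubset K n)
    (le0 : rel 'X_{1..n}) (z : 'rV[int]_n) : Prop :=
  forall le, term_order le -> same_lead I le le0 -> nonneg_in le z.

Section GroebnerDual.
Variables (K : fieldType) (n : nat) (I : psubset K n) (le0 : rel 'X_{1..n}).
Hypotheses (idI : is_ideal I) (ord0 : term_order le0).
Local Notation dual := (groebner_dual I le0).

Lemma groebner_dual_nonneg z : dual z -> nonneg_in le0 z.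
Proof. by apply. Qed.

Lemma groebner_dual_expv u : dual (expv u).
Proof. by move=> le ord _; apply: nonneg_in_expv. Qed.

Lemma groebner_dualD y z : dual y -> dual z -> dual (y + z).
Proof.
by move=> dy dz le ord same; apply: nonneg_inD; [|apply: dy|apply: dz].
Qed.

Lemma groebner_dualMn z k : dual z -> dual (z *+ k).
Proof. by move=> dz le ord same; apply: nonneg_inMn; [|apply: dz]. Qed.

Lemma groebner_dualMn_cancel z k : (0 < k)%N -> dual (z *+ k) -> dual z.
Proof.
move=> k0 dz le ord same; apply: (nonneg_inMn_cancel ord k0).
exact: dz.
Qed.

(** All monomials of 'X_[a] - g other than a are standard, so every order with
    the same initial ideal as le0 has to pick a as initial monomial. *)
Lemma groebner_dual_tail a g b : lead_mnm le0 I a ->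
  I ('X_[a] - g) -> (forall m, m \in msupp g -> ~ lead_mnm le0 I m) ->
  b \in msupp g -> dual (expv a - expv b).
Proof.
move=> lead_a Ir sg bg le ord same; apply/(nonneg_inB ord).
have ag : a \notin msupp g by apply/negP => /sg.
have r_a : a \in msupp ('X_[a] - g).
  by rewrite mcoeff_msupp mcoeffB mcoeffX eqxx (memN_msupp_eq0 ag) subr0
    oner_neq0.
have r_b : b \in msupp ('X_[a] - g).
  rewrite mcoeff_msupp mcoeffB mcoeffX; case: (a =P b) => [ab|_].
    by move: bg; rewrite -ab (negPf ag).
  by rewrite sub0r oppr_eq0 -mcoeff_msupp.
have [|m [mr le_m]] := initial_monomial_exists ord (f := 'X_[a] - g).
  by apply: contraTneq r_a => ->; rewrite mcoeff_msupp mcoeff0 eqxx.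
have /same lead_m : lead_mnm le I m by exists ('X_[a] - g).
move: (mr) => /msuppB_le; rewrite mem_cat => /orP[/mem_msuppXP ->|/sg //].
exact: le_m.
Qed.

(** The inequalities of [groebner_dual_tail] make each a initial in
    'X_[a] minus its normal form, so the initial ideal of le contains that of
    le0, and [same_lead_sub] applies. *)
Lemma same_lead_of_dual le :
  term_order le -> (forall z, dual z -> nonneg_in le z) -> same_lead I le le0.
Proof.
move=> ord dual_le a; symmetry; apply: same_lead_sub => // {}a lead_a.
have [g Ir sg] := normal_form_exists ord0 'X_[a] idI.
exists ('X_[a] - g) => //; split.
  have ag : a \notin msupp g by apply/negP => /sg.
  by rewrite mcoeff_msupp mcoeffB mcoeffX eqxx (memN_msupp_eq0 ag) subr0
    oner_neq0.
case: (ord) => [[lexx _ _ _] _ _].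
move=> b /msuppB_le; rewrite mem_cat => /orP[/mem_msuppXP <- //|bg].
apply/(nonneg_inB ord)/dual_le.
exact: groebner_dual_tail Ir sg bg.
Qed.

End GroebnerDual.

Definition only_lead (K : fieldType) (n : nat) (I : psubset K n)
    (le1 le2 : rel 'X_{1..n}) : Prop :=
  forall le, term_order le -> same_lead I le le1 \/ same_lead I le le2.

Section Wall.
Variables (K : fieldType) (n : nat) (I : psubset K n) (le1 le2 : rel 'X_{1..n}).
Hypotheses (idI : is_ideal I) (ord1 : term_order le1) (ord2 : term_order le2).
Hypotheses (only12 : only_lead I le1 le2) (neq12 : ~ same_lead I le1 le2).
Local Notation dual1 := (groebner_dual I le1).
Local Notation dual2 := (groebner_dual I le2).

(** If the sum P of the two dual cones were pointed, an order extending it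
    would have both initial ideals.  Otherwise z and - z lie in P for some
    nonzero z, and collecting the contributions of the first dual cone gives
    the required c. *)
Lemma wall_exists : exists c : 'rV[int]_n, [/\ c != 0, dual1 c & dual2 (- c)].
Proof.
apply: boolp.contrapT => no_c.
pose P z := exists y1 y2, [/\ dual1 y1, dual2 y2 & z = y1 + y2].
have dual0 le : groebner_dual I le 0.
  by rewrite -(@expv0 n); apply: groebner_dual_expv.
have P1 y : dual1 y -> P y by exists y, 0; split; rewrite ?addr0.
have P2 y : dual2 y -> P y by exists 0, y; split; rewrite ?add0r.
have [||le ord Ple] := @cone_extends_to_order n P.
- split; first exact/P1/dual0.
    move=> _ _ [y1 [y2 [d1 d2 ->]]] [z1 [z2 [e1 e2 ->]]].
    exists (y1 + z1), (y2 + z2); rewrite addrACA.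
    by split=> //; apply: groebner_dualD.
  move=> z [y1 [y2 [d1 d2 zE]]] [z1 [z2 [e1 e2 NzE]]].
  have sum0 : y1 + z1 = - (y2 + z2).
    by apply/eqP; rewrite -addr_eq0 addrACA -zE -NzE subrr.
  have sum1 : y1 + z1 = 0.
    apply: boolp.contrapT => /eqP sum_neq0; apply: no_c; exists (y1 + z1).
    split=> //; first exact: groebner_dualD.
    by rewrite sum0 opprK; apply: groebner_dualD.
  have y1_0 : y1 = 0.
    apply: (nonneg_in_anti ord1 (groebner_dual_nonneg ord1 d1)).
    by rewrite (addr0_eq sum1); apply: (groebner_dual_nonneg ord1 e1).
  have /addr0_eq y2_N : y2 + z2 = 0 by apply/eqP; rewrite -oppr_eq0 -sum0 sum1.
  rewrite zE y1_0 add0r.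
  apply: (nonneg_in_anti ord2 (groebner_dual_nonneg ord2 d2)).
  by rewrite y2_N; apply: (groebner_dual_nonneg ord2 e2).
- by move=> u; apply/P1/groebner_dual_expv.
apply: neq12 => m.
have /(_ m)<- : same_lead I le le1 by apply: same_lead_of_dual => // z /P1/Ple.
by apply: same_lead_of_dual => // z /P2/Ple.
Qed.

Section Sides.
Variable c : 'rV[int]_n.
Hypotheses (c_neq0 : c != 0) (c_dual1 : dual1 c) (c_dual2 : dual2 (- c)).

(** An order that makes c nonnegative and has the second initial ideal would
    make both c and - c nonnegative. *)
Lemma same_lead_side le : term_order le -> nonneg_in le c -> same_lead I le le1.
Proof.
move=> ord pos_c; case: (only12 ord) => // same2.
by case/eqP: c_neq0; apply: (nonneg_in_anti ord) => //; apply: c_dual2.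
Qed.

(** Otherwise - c lies in the orthant, which is nonnegative for le1, as is c. *)
Lemma wall_pos_coord : exists i, 0 < c 0 i.
Proof.
apply: boolp.contrapT => no_i; case/eqP: c_neq0.
have [i|u uE] := @expv_ge0 _ (- c).
  by rewrite mxE oppr_ge0 leNgt; apply/negP => ci; apply: no_i; exists i.
apply: (nonneg_in_anti ord1 (groebner_dual_nonneg ord1 c_dual1)).
by rewrite -uE; apply: nonneg_in_expv.
Qed.

(** Farkas' lemma: an order with c nonnegative makes d nonnegative, so the cone
    generated by c, the orthant and - d is not pointed unless d = 0.  The
    relation that destroys pointedness expresses a multiple of d through c and
    the orthant. *)
Lemma dual1_halfspace d : dual1 d ->
  exists N k u, (0 < N)%N /\ d *+ N = c *+ k + expv u.
Proof.
move=> d_dual1; apply: boolp.contrapT => no_N.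
pose P z := exists N k u, z = c *+ k + expv u - d *+ N.
have nonneg_ck k u : nonneg_in le1 (c *+ k + expv u).
  apply: (groebner_dual_nonneg ord1 (I := I)); apply: groebner_dualD.
    exact: groebner_dualMn.
  exact: groebner_dual_expv.
have [||le ord Ple] := @cone_extends_to_order n P.
- split; first by exists 0%N, 0%N, 0%MM; rewrite expv0 !mulr0n subr0 addr0.
    move=> _ _ [N [k [u ->]]] [N' [k' [u' ->]]];
      exists (N + N')%N, (k + k')%N, (u + u')%MM.
    by rewrite expvD !mulrnDr opprD addrACA [c *+ _ + _ + _]addrACA.
  move=> z [N [k [u zE]]] [N' [k' [u' NzE]]].
  have sum0 : d *+ (N + N') = c *+ (k + k') + expv (u + u').
    have : c *+ k + expv u - d *+ N + (c *+ k' + expv u' - d *+ N') = 0.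
      by rewrite -zE -NzE subrr.
    by rewrite addrACA -opprD => /subr0_eq;
      rewrite expvD !mulrnDr addrACA => ->.
  have [NN'|NN'] := posnP (N + N'); last by case: no_N;
    exists (N + N')%N, (k + k')%N, (u + u')%MM.
  move/eqP: NN' zE NzE; rewrite addn_eq0 => /andP[/eqP -> /eqP ->].
  rewrite !mulr0n !subr0 => zE NzE.
  by apply: (nonneg_in_anti ord1); rewrite ?NzE ?zE; apply: nonneg_ck.
- by move=> u; exists 0%N, 0%N, u; rewrite !mulr0n subr0 add0r.
have pos_c : nonneg_in le c.
  by apply: Ple; exists 0%N, 1%N, 0%MM; rewrite expv0 mulr0n subr0 addr0.
have d0 : d = 0.
  apply: (nonneg_in_anti ord); first exact/d_dual1/same_lead_side.
  by apply: Ple; exists 1%N, 0%N, 0%MM; rewrite expv0 mulr0n !add0r.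
by apply: no_N; exists 1%N, 0%N, 0%MM; rewrite d0 expv0 mulr0n addr0.
Qed.

Lemma weight_dual1 w d : (forall i, 0 < w i)%N -> weight w c = 0 -> dual1 d ->
  0 <= weight w d /\
  (weight w d = 0 -> exists N k, (0 < N)%N /\ d *+ N = c *+ k).
Proof.
move=> w0 wc /dual1_halfspace[N [k [u [N0 dN]]]].
have wdN : weight w d *+ N = weight w (expv u).
  by rewrite -raddfMn dN raddfD raddfMn /= wc mul0rn add0r.
split; first by rewrite -(pmulrn_lge0 _ N0) wdN weight_expv_ge0.
move=> wd; exists N, k; split=> //.
by rewrite dN (weight_expv_eq0 w0 (u := u)) ?expv0 ?addr0 // -wdN wd mul0rn.
Qed.

End Sides.
End Wall.

(** Vectors of the first dual cone that are orthogonal to w are, up to a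
    positive multiple, multiples of c.  To have them in Zc itself, c is chosen
    with a least positive i-th coordinate among the wall vectors, and d is
    divided by c in that coordinate. *)
Lemma primitive_wall_exists (K : fieldType) (n : nat)
    (I : psubset K n) le1 le2 :
  is_ideal I -> term_order le1 -> term_order le2 ->
  only_lead I le1 le2 -> ~ same_lead I le1 le2 ->
  exists (c : 'rV[int]_n) (w : 'I_n -> nat),
    [/\ [/\ c != 0, groebner_dual I le1 c & groebner_dual I le2 (- c)],
        forall i, (0 < w i)%N, weight w c = 0
      & forall d, groebner_dual I le1 d -> 0 <= weight w d /\
          (weight w d = 0 -> exists k : int, d = k *: c)].
Proof.
move=> idI ord1 ord2 only12 neq12.
pose C z := groebner_dual I le1 z /\ groebner_dual I le2 (- z).
have [c0 [c0_neq0 c0_dual1 c0_dual2]] := wall_exists idI ord1 ord2 neq12.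
have [i c0i] := wall_pos_coord ord1 c0_neq0 c0_dual1.
have C_cancel N k (d c : 'rV[int]_n) : (0 < N)%N -> C c ->
  d *+ N = c *+ k -> C d.
  move=> N0 [c1 c2] dN; split; apply: (groebner_dualMn_cancel N0).
    by rewrite dN; apply: groebner_dualMn.
  by rewrite mulNrn dN -mulNrn; apply: groebner_dualMn.
have [c [Cc ci c_min]] : exists c : 'rV[int]_n, [/\ C c, 0 < c 0 i
    & forall d, C d -> 0 < d 0 i -> c 0 i <= d 0 i].
  pose p m := boolp.asbool (exists d, [/\ C d, 0 < d 0 i & d 0 i = m%:Z]).
  have ex_p : exists m, p m.
    by exists (absz (c0 0 i)); apply/boolp.asboolP; exists c0; rewrite gtz0_abs.
  have [m /boolp.asboolP[c [Cc ci cm]] m_min] := ex_minnP ex_p.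
  exists c; split=> // d Cd di.
  rewrite cm -[d 0 i]gtz0_abs // lez_nat; apply: m_min.
  by apply/boolp.asboolP; exists d; rewrite gtz0_abs.
have c_neq0 : c != 0 by apply: contraTneq ci => ->; rewrite mxE ltxx.
case: (Cc) => c1 c2.
have [j Ncj] : exists j, 0 < (- c) 0 j.
  by apply: (wall_pos_coord ord2 _ c2); rewrite oppr_eq0.
have [w w0 wc] : exists2 w : 'I_n ->
  nat, (forall i, 0 < w i)%N & weight w c = 0.
  apply: orthogonal_weight_exists; first by exists i.
  by exists j; move: Ncj; rewrite mxE oppr_gt0.
exists c, w; split=> // d d1.
have [wd_ge0 wd_line] := weight_dual1 ord1 only12 c_neq0 c1 c2 w0 wc d1.
split=> // /wd_line[N [k [N0 dN]]].
pose q := (d 0%R i %/ c 0%R i)%Z; pose e := d - q *: c;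
  pose l := k%:Z - q * N%:Z.
have eN : e *+ N = l *: c.
  by rewrite mulrnBl dN scalerBl -!scaler_nat !natz scalerA mulrC.
have ei : e 0 i = (d 0%R i %% c 0%R i)%Z by rewrite !mxE /modz.
have ei_ge0 : 0 <= e 0 i by rewrite ei modz_ge0 ?gt_eqF.
have ei_lt : e 0 i < c 0 i by rewrite ei ltz_pmod.
have eiN : e 0 i *+ N = l * c 0 i by rewrite -mulmxnE eN mxE.
have [ei0|ei_neq0] := eqVneq (e 0 i) 0.
  exists q; apply/eqP; rewrite -subr_eq0; apply/eqP/(rowMn_eq0 N0).
  move/eqP: eiN; rewrite ei0 mul0rn eq_sym mulf_eq0 (gt_eqF ci) orbF => /eqP l0.
  by rewrite -/e eN l0 scale0r.
have ei_gt0 : 0 < e 0 i by rewrite lt_neqAle eq_sym ei_neq0.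
have l_gt0 : 0 < l by rewrite -(pmulr_lgt0 _ ci) -eiN pmulrn_lgt0.
have Ce : C e.
  by apply: (C_cancel N (absz l) e c N0 Cc);
    rewrite eN -scaler_nat natz gtz0_abs.
by have := c_min e Ce ei_gt0; rewrite leNgt ei_lt.
Qed.

Lemma homogeneous_idealW (K : fieldType) (n : nat)
    (R R' : 'X_{1..n} -> 'X_{1..n} -> Prop) (J : psubset K n) :
  (forall u v, R u v -> R' u v) -> homogeneous_ideal R J ->
    homogeneous_ideal R' J.
Proof.
move=> RR' [idJ homJ]; split=> // f; split=> [/homJ genf|]; last first.
  by apply => // g [].
move=> J' idJ' J'hom; apply: genf => // g [Jg homg]; apply: J'hom; split=> //.
by move=> u v ug vg; apply/RR'/homg.
Qed.

(** * Initial forms with respect to a weight *)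

(** In each weight k, the component of f is the top component of an element of
    I, or 0.  This describes the span of the w-initial forms of I componentwise,
    without generators. *)
Definition initial_form_ideal (K : fieldType) (n : nat) (w : 'I_n -> nat)
    (I : psubset K n) : psubset K n :=
  fun f => forall k : int, exists g,
    [/\ I g, forall m, m \in msupp g -> weight w (expv m) <= k
      & forall m, weight w (expv m) = k -> g@_m = f@_m].

Definition weight_refine (n : nat) (w : 'I_n -> nat) (le : rel 'X_{1..n}) :
    rel 'X_{1..n} :=
  fun a b => (weight w (expv a) < weight w (expv b)) ||
    (weight w (expv a) == weight w (expv b)) && le a b.

Section InitialForms.
Variables (K : fieldType) (n : nat) (w : 'I_n -> nat).
Implicit Types (I : psubset K n) (le : rel 'X_{1..n}).
Local Notation wt m := (weight w (expv m)).

Lemma weight_refine_order le : term_order le -> term_order (weight_refine w le).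
Proof.
case=> [[lexx le_anti le_trans le_total] le0 leD]; rewrite /weight_refine.
split; first split.
- by move=> a; rewrite ltxx eqxx lexx.
- move=> a b; case: (ltgtP (wt a) (wt b)) => //= _; exact: le_anti.
- move=> b a d; case: (ltgtP (wt a) (wt b)) => //= [ab|->].
    by case: (ltgtP (wt b) (wt d)) => //= [bd _ _|<- _ _];
      rewrite ?ab // (lt_trans ab bd).
  by case: (ltgtP (wt b) (wt d)) => //= _; apply: le_trans.
- by move=> a b; case: (ltgtP (wt a) (wt b)) => //= _; apply: le_total.
- move=> m; rewrite expv0 raddf0 lt_neqAle weight_expv_ge0 andbT.
  by case: eqVneq => //= _; apply: le0.
- move=> a b m; rewrite !expvD !raddfD /= ltrD2r (inj_eq (addIr _)).
  by case/orP=> [->//|/andP[-> /leD->]]; rewrite orbT.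
Qed.

Lemma weight_refine_nonneg le z :
  weight w z = 0 -> nonneg_in le z -> nonneg_in (weight_refine w le) z.
Proof.
move=> wz [u [v [zE le_vu]]]; exists u, v; split=> //.
rewrite /weight_refine le_vu andbT; apply/orP; right.
by rewrite eq_sym -subr_eq0 -raddfB zE /= wz.
Qed.

Lemma mcoeffMX_eq (f g : {mpoly K[n]}) m u :
  (forall v, u = (m + v)%MM -> f@_v = g@_v) ->
    (f * 'X_[m])@_u = (g * 'X_[m])@_u.
Proof.
have [m_u|m_u] := boolP (m <= u)%MM => [/(_ (u - m)%MM)|_].
  rewrite [(m + (u - m))%MM]addmC submK // => /(_ erefl) fg.
  by rewrite -(submK m_u) [(u - m + m)%MM]addmC !mcoeffMX.
have nsupp (p : {mpoly K[n]}) : (p * 'X_[m])@_u = 0.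
  apply: memN_msupp_eq0; rewrite (perm_mem (msuppMX _ _)).
  by apply: contra m_u => /mapP[v _ ->]; apply: lem_addr.
by rewrite !nsupp.
Qed.

Lemma initial_form_ideal_ideal I : is_ideal I ->
  is_ideal (initial_form_ideal w I).
Proof.
move=> [I0 ID IM].
have J0 : initial_form_ideal w I 0.
  by move=> k; exists 0; split=> // m; rewrite mcoeff_msupp mcoeff0 eqxx.
have JD f g : initial_form_ideal w I f -> initial_form_ideal w I g ->
    initial_form_ideal w I (f + g).
  move=> Jf Jg k; have [f' [If f'k ff']] := Jf k;
    have [g' [Ig g'k gg']] := Jg k.
  exists (f' + g'); split; first exact: ID.
    by move=> m /msuppD_le; rewrite mem_cat => /orP[/f'k|/g'k].
  by move=> m mk; rewrite !mcoeffD ff' ?gg'.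
split=> // p f Jf; rewrite [p]mpolyE mulr_suml.
apply: big_ind => // m _ k; have [g [Ig gk gf]] := Jf (k - wt m).
exists (p@_m *: (g * 'X_[m])); split.
- by rewrite -mul_mpolyC mulrA mulrAC; apply: (IM).
- move=> u /msuppZ_le; rewrite (perm_mem (msuppMX _ _)) => /mapP[v /gk vk ->].
  by rewrite expvD raddfD /= addrC -lerBrDr.
- move=> u uk; rewrite -scalerAl !mcoeffZ ['X_[m] * f]mulrC; congr (_ * _).
  apply: mcoeffMX_eq => v uE; apply: gf.
  by rewrite -uk uE expvD raddfD /= addrAC subrr add0r.
Qed.

(** The refined order looks at the initial form first and then uses le within
    it. *)
Lemma lead_mnm_initial_form I le m : is_ideal I ->
  lead_mnm le (initial_form_ideal w I) m <-> lead_mnm (weight_refine w le) I m.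
Proof.
move=> [I0 _ _]; rewrite /weight_refine; split.
- move=> [f Jf [mf f_le]]; have [g [Ig g_le gf]] := Jf (wt m).
  exists g => //; split; first by rewrite mcoeff_msupp gf // -mcoeff_msupp.
  move=> u ug; have := g_le u ug; rewrite le_eqVlt => /predU1P[um|->//].
  apply/orP; right; rewrite um eqxx /=; apply: f_le.
  by rewrite mcoeff_msupp -gf // -mcoeff_msupp.
- move=> [g Ig [mg g_le]]; exists (mrestr (fun u => wt u == wt m) g).
    move=> k; have [->|km] := eqVneq k (wt m).
      exists g; split=> //.
        move=> u /g_le; rewrite le_eqVlt => /orP[->|/andP[-> _]//].
        by rewrite orbT.
      by move=> u um; rewrite mcoeff_mrestr um eqxx.
    exists 0; split=> //; first by move=> u; rewrite mcoeff_msupp mcoeff0 eqxx.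
    by move=> u uk; rewrite mcoeff_mrestr uk (negPf km) mcoeff0.
  split; first by rewrite msupp_mrestr eqxx mg.
  move=> u; rewrite msupp_mrestr => /andP[/eqP um /g_le].
  by rewrite um ltxx eqxx.
Qed.

End InitialForms.

(** * The edge ideal on the wall *)

Section ReducedBasis.
Variables (K : fieldType) (n : nat) (le : rel 'X_{1..n}) (J : psubset K n).
Hypotheses (ord : term_order le) (idJ : is_ideal J).
Variable h : 'X_{1..n} -> {mpoly K[n]}.
Hypothesis hP : forall a, lead_mnm le J a ->
  [/\ J (h a), (h a)@_a = 1
    & forall m, m \in msupp (h a) -> m != a -> ~ lead_mnm le J m].

(** Both sides agree on the nonstandard monomials, since h a has a as its only
    nonstandard monomial, with coefficient 1; so their difference is 0 by
    [standard_eq0]. *)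
Lemma reduced_basis_span f : J f ->
  f = \sum_(a <- msupp f | boolp.asbool (lead_mnm le J a)) f@_a *: h a.
Proof.
move=> Jf; apply/eqP; rewrite -subr_eq0; apply/eqP.
have subJ := ideal_submodule idJ.
apply: (standard_eq0 ord (I := J)).
  apply: (submoduleB subJ Jf); apply: (submodule_sum subJ).
  move=> a _ /boolp.asboolP/hP[Jh _ _].
  by case: (subJ) => _ _; apply.
move=> m; rewrite mcoeff_msupp => /eqP m_supp lead_m; apply: m_supp.
rewrite mcoeffB raddf_sum /=.
have coef a : lead_mnm le J a -> a != m -> (f@_a *: h a)@_m = 0.
  move=> /hP[_ _ h_std] am; rewrite mcoeffZ [(h a)@_m]memN_msupp_eq0 ?mulr0 //.
  apply/negP => /h_std nlead.
  by apply: nlead lead_m; rewrite eq_sym.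
have [mf|mf] := boolP (m \in msupp f).
  rewrite big_mkcond (bigD1_seq m) ?msupp_uniq //= big1 => [|a am].
    case: boolp.asboolP => // _; have [_ h_m _] := hP lead_m.
    by rewrite mcoeffZ h_m mulr1 addr0 subrr.
  by case: boolp.asboolP => // lead_a; apply: coef.
rewrite (memN_msupp_eq0 mf) sub0r big_seq_cond big1 ?oppr0 // => a.
case/andP=> af /boolp.asboolP lead_a; apply: coef => //.
by apply: contraNneq mf => <-.
Qed.

End ReducedBasis.

(** Closure under taking components for the grading by Z^n/Zc and for every
    coarsening of it. *)
Definition coset_graded (K : fieldType) (n : nat) (c : 'rV[int]_n)
    (J : psubset K n) : Prop :=
  forall P : pred 'X_{1..n}, (forall u v, same_coset c u v -> P u = P v) ->
    forall f, J f -> J (mrestr P f).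

(** J is the ideal of w-initial forms for a weight w orthogonal to the wall
    vector c.  For a nonstandard a, the top part h a of 'X_[a] - g, where g is
    the normal form of 'X_[a], lives on a + Zc, because the exponent
    differences lie in the dual cone and those of weight 0 are multiples of c.
    The h a form a reduced basis of J. *)
Lemma edge_ideal_exists (K : fieldType) (n : nat) (I : psubset K n) le1 le2 :
  is_ideal I -> term_order le1 -> term_order le2 ->
  only_lead I le1 le2 -> ~ same_lead I le1 le2 ->
  exists (J : psubset K n) (c : 'rV[int]_n),
    [/\ [/\ is_ideal J, coset_graded c J & homogeneous_ideal (same_coset c) J],
        [/\ exists i, 0 < c 0 i, exists j, c 0 j < 0,
            nonneg_in le1 c & nonneg_in le2 (- c)],
        forall m, lead_mnm le1 J m <-> lead_mnm le1 I m,
        forall m, lead_mnm le2 J m <-> lead_mnm le2 I m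
      & forall le, term_order le -> exists2 le', term_order le' &
          forall m, lead_mnm le J m <-> lead_mnm le' I m].
Proof.
move=> idI ord1 ord2 only12 neq12.
have only21 : only_lead I le2 le1 by move=> le /only12 /or_comm.
have [c [w [[c_neq0 c1 c2] w0 wc wall]]] :=
  primitive_wall_exists idI ord1 ord2 only12 neq12.
pose J := initial_form_ideal w I.
have idJ : is_ideal J by apply: initial_form_ideal_ideal.
have subJ := ideal_submodule idJ.
have Nc_neq0 : - c != 0 by rewrite oppr_eq0.
have wNc : weight w (- c) = 0 by rewrite raddfN /= wc oppr0.
have pos_c := groebner_dual_nonneg ord1 c1.
have pos_Nc := groebner_dual_nonneg ord2 c2.
have lead1 m : lead_mnm le1 J m <-> lead_mnm le1 I m.
  rewrite lead_mnm_initial_form //.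
  apply: (same_lead_side only12 c_neq0 c2 (weight_refine_order w ord1)).
  exact: weight_refine_nonneg.
have lead2 m : lead_mnm le2 J m <-> lead_mnm le2 I m.
  rewrite lead_mnm_initial_form //.
  apply: (same_lead_side only21 Nc_neq0 _ (weight_refine_order w ord2)).
    by rewrite opprK.
  exact: weight_refine_nonneg.
have /boolp.choice[h hP] a : exists f, lead_mnm le1 J a ->
    [/\ [/\ J f, f@_a = 1 &
        forall m, m \in msupp f -> m != a -> ~ lead_mnm le1 J m]
      & forall m, m \in msupp f -> same_coset c a m].
  have [/lead1 lead_a|] := boolp.EM (lead_mnm le1 J a); last by exists 0.
  have [g Ir sg] := normal_form_exists ord1 'X_[a] idI.
  have tail b := @groebner_dual_tail _ _ _ _ a g b lead_a Ir sg.
  have ag : a \notin msupp g by apply/negP => /sg.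
  have r_supp m : m \in msupp ('X_[a] - g) -> m = a \/ m \in msupp g.
    by move/msuppB_le; rewrite mem_cat => /orP[/mem_msuppXP|]; [left | right].
  exists (mrestr (fun m =>
    weight w (expv m) == weight w (expv a)) ('X_[a] - g)).
  move=> _; split; first split.
  - move=> k; have [->|ka] := eqVneq k (weight w (expv a)).
      exists ('X_[a] - g); split=> //.
        move=> m /r_supp[-> //|/tail/wall[]].
        by rewrite raddfB /= subr_ge0.
      by move=> m ma; rewrite mcoeff_mrestr ma eqxx.
    exists 0; split; first by case: idI.
      by move=> m; rewrite mcoeff_msupp mcoeff0 eqxx.
    by move=> m mk; rewrite mcoeff_mrestr mk (negPf ka) mcoeff0.
  - by rewrite mcoeff_mrestr eqxx mcoeffB mcoeffX eqxx (memN_msupp_eq0 ag)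
      subr0.
  - move=> m; rewrite msupp_mrestr => /andP[_ /r_supp[->|/sg std_m]].
      by rewrite eqxx.
    by move=> _ /lead1.
  - move=> m; rewrite msupp_mrestr => /andP[/eqP wm /r_supp[->|/tail/wall[_]]].
      by exists 0; rewrite subrr scale0r.
    by apply; rewrite raddfB /= wm subrr.
have hJ a (lead_a : lead_mnm le1 J a) := (hP a lead_a).1.
have span := reduced_basis_span ord1 idJ hJ.
have J_h a : boolp.asbool (lead_mnm le1 J a) -> J (h a).
  by move=> /boolp.asboolP/hP[[]].
have sum_in (S : psubset K n) (F : 'X_{1..n} -> {mpoly K[n]}) f :
    submodule S -> (forall a, boolp.asbool (lead_mnm le1 J a) -> S (F a)) ->
    S (\sum_(a <- msupp f | boolp.asbool (lead_mnm le1 J a)) f@_a *: F a).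
  move=> subS SF; apply: submodule_sum => // a _ /SF.
  by case: subS => _ _; apply.
exists J, c; split=> //.
- split=> //.
    move=> P Pc f /span ->; rewrite raddf_sum /=.
    rewrite (eq_bigr (fun a => f@_a *: mrestr P (h a))) => [|a _];
      last by rewrite linearZ.
    apply: (sum_in J) => // a lead_a.
    have [Pa|nPa] := boolP (P a).
      suff -> : mrestr P (h a) = h a by apply: J_h.
      apply/mpolyP => m; rewrite mcoeff_mrestr; case: ifP => // nPm.
      rewrite memN_msupp_eq0 //; apply/negP.
      by move/boolp.asboolP: lead_a => /hP[_ h_coset] /h_coset/Pc;
        rewrite Pa nPm.
    suff -> : mrestr P (h a) = 0 by case: idJ.
    apply/mpolyP => m; rewrite mcoeff_mrestr mcoeff0; case: ifP => // Pm.
    rewrite memN_msupp_eq0 //; apply/negP.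
    by move/boolp.asboolP: lead_a => /hP[_ h_coset] /h_coset/Pc;
      rewrite (negPf nPa) Pm.
  split=> // f; split=> [/span ->|]; last by apply; [|move=> g []].
  apply: sum_in; first exact/ideal_submodule/ideal_gen_ideal.
  move=> a lead_a; apply: ideal_gen_sub; split; first exact: J_h.
  move=> u v; move/boolp.asboolP: lead_a =>
    /hP[_ h_coset] /h_coset[k au] /h_coset[l av].
  by exists (l - k); rewrite scalerBl -au -av opprB [RHS]addrC addrA subrK.
- split=> //; first exact: wall_pos_coord c1.
  have [j] := wall_pos_coord ord2 Nc_neq0 c2; rewrite mxE oppr_gt0 => cj.
  by exists j.
- move=> le ord; exists (weight_refine w le); first exact: weight_refine_order.
  by move=> m; apply: lead_mnm_initial_form.
Qed.

(** * Hilbert functions *)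

(** The quotient V/W1 maps onto V/W2, and both have dimension d, so the map is
    injective.  In coordinates: A expresses the basis b' of V/W2 through the
    basis b of V/W1, and is invertible because b' is independent modulo W2. *)
Lemma quotient_dim_eq (K : fieldType) (n : nat)
    (V W1 W2 : psubset K n) (d : nat) :
  submodule V -> submodule W1 -> submodule W2 ->
  (forall f, V f -> W1 f -> W2 f) ->
  quotient_dim V W1 d -> quotient_dim V W2 d ->
  forall f, V f -> W2 f -> W1 f.
Proof.
move=> subV sub1 sub2 W12 [b [Vb b_free b_span]] [b' [Vb' b'_free b'_span]].
pose lc (e : 'I_d -> {mpoly K[n]}) (x : 'rV[K]_d) := \sum_i x 0 i *: e i.
have V_lc e x : (forall i, V (e i)) -> V (lc e x).
  by move=> Ve; apply: submodule_lincomb.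
have coord f : exists x : 'rV_d, V f -> W1 (f - lc b x).
  have [/b_span[x Wx]|nVf] := boolp.EM (V f); last by exists 0.
  exists (\row_i x i) => _; rewrite /lc.
  by under eq_bigr do rewrite mxE.
have /boolp.choice[a aP] i := coord (b' i).
pose A := \matrix_i a i.
have change x : W1 (lc b' x - lc b (x *m A)).
  have -> : lc b' x - lc b (x *m A) = \sum_i x 0 i *: (b' i - lc b (a i)).
    under [RHS]eq_bigr do rewrite scalerBr; rewrite sumrB; congr (_ - _).
    rewrite /lc; under [RHS]eq_bigr do rewrite scaler_sumr.
    rewrite exchange_big; apply: eq_bigr => j _; rewrite !mxE scaler_suml.
    by apply: eq_bigr => i _; rewrite mxE scalerA.
  by apply: submodule_lincomb => // i; apply: aP.
have V_change x : V (lc b' x - lc b (x *m A)).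
  by apply: submoduleB => //; apply: V_lc.
have W2_change x : W2 (lc b' x - lc b (x *m A)) by apply: W12.
have A_unit : A \in unitmx.
  rewrite -row_free_unit; apply/row_freeP.
  suff /eqP kerA : kermx A == 0.
    apply/row_freeP; rewrite -kermx_eq0 kerA eqxx //.
  apply/eqP/row_matrixP => i; rewrite row0.
  have kA : row i (kermx A) *m A = 0 by rewrite -row_mul mulmx_ker row0.
  apply/rowP => j; rewrite [RHS]mxE.
  apply: (b'_free (fun j => row i (kermx A) 0 j)).
  have := W2_change (row i (kermx A)); rewrite kA /lc.
  by rewrite [X in _ - X]big1 ?subr0 // => k _; rewrite mxE scale0r.
move=> f Vf W2f.
have [x fx] := coord f; have {fx}W1_fx := fx Vf.
pose y := x *m invmx A.
have xE : x = y *m A by rewrite mulmxKV.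
have W1_fy : W1 (f - lc b' y).
  have -> : f - lc b' y = (f - lc b x) - (lc b' y - lc b (y *m A)).
    by rewrite -xE opprB addrA subrK.
  exact: submoduleB.
have y0 : y = 0.
  apply/rowP => i; rewrite [RHS]mxE; apply: (b'_free (fun i => y 0 i)).
  rewrite -/(lc b' y) -[lc b' y](subKr f).
  apply: submoduleB => //; apply: W12 => //.
  by apply: submoduleB => //; apply: V_lc.
by move: W1_fy; rewrite y0 /lc big1 ?subr0 // => i _; rewrite mxE scale0r.
Qed.

Lemma same_coset_congr (n : nat) (c : 'rV[int]_n) (u v m : 'X_{1..n}) :
  same_coset c u v -> same_coset c m u <-> same_coset c m v.
Proof.
move=> [k uv]; split=> [] [l mE].
  by exists (l + k); rewrite scalerDl -uv -mE addrA subrK.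
by exists (l - k); rewrite scalerBl -uv -mE opprB addrA subrK.
Qed.

Section Grading.
Variables (K : fieldType) (n q : nat).
Variable deg : {additive 'rV[int]_n -> 'rV[int]_q}.
Hypothesis deg_pos : positive_grading deg.
Implicit Types (J M : psubset K n) (u v m : 'X_{1..n}).

Lemma graded_piece_submodule a : submodule (@graded_piece K n q deg a).
Proof.
split=> [u|f g fa ga u|x f fa u]; first by rewrite mcoeff_msupp mcoeff0 eqxx.
  by move/msuppD_le; rewrite mem_cat => /orP[/fa|/ga].
by move/msuppZ_le/fa.
Qed.

Lemma same_coset_degree c u v k :
  expv u - expv v = k *: c -> deg (expv u) = deg (expv v) + k *: deg c.
Proof.
move=> uv; apply/eqP; rewrite addrC -subr_eq -raddfB uv.
by rewrite -[k]intz !scaler_int raddfMz.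
Qed.

(** The standard monomials form a basis modulo both J and its initial ideal M,
    so the standard parts of a basis modulo M are a basis modulo J.  Since
    deg c = 0, taking the component of degree a preserves J. *)
Lemma quotient_dim_initial J M le c a d :
  term_order le -> is_ideal J -> coset_graded c J -> deg c = 0 ->
  (forall f, M f <-> forall m, m \in msupp f -> lead_mnm le J m) ->
  quotient_dim (@graded_piece K n q deg a) M d ->
  quotient_dim (@graded_piece K n q deg a) J d.
Proof.
move=> ord idJ gradJ deg_c M_lead [b [b_deg b_free b_span]].
pose std := boolp.asbool \o (fun m => ~ lead_mnm le J m).
have stdP m : reflect (~ lead_mnm le J m) (std m) by apply: boolp.asboolP.
have std0 f : J f -> (forall m, m \in msupp f -> std m) -> f = 0.
  by move=> Jf f_std; apply: (standard_eq0 ord Jf) => m /f_std/stdP.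
have M_std f : M f <-> mrestr std f = 0.
  rewrite M_lead; split=> [f_lead|/mpolyP f0 m mf].
    apply/mpolyP => m; rewrite mcoeff_mrestr mcoeff0; case: stdP => // nlead.
    by apply: memN_msupp_eq0; apply/negP => /f_lead.
  apply: boolp.contrapT => /stdP std_m; have := f0 m.
  by rewrite mcoeff_mrestr std_m mcoeff0 => /eqP; rewrite mcoeff_eq0 mf.
have std_sum (x : 'I_d -> K) :
    mrestr std (\sum_i x i *: b i) = \sum_i x i *: mrestr std (b i).
  by rewrite raddf_sum; apply: eq_bigr => i _; rewrite /= linearZ.
exists (fun i => mrestr std (b i)); split.
- by move=> i u; rewrite msupp_mrestr => /andP[_]; apply: b_deg.
- move=> x Jx; apply: b_free; apply/M_std; rewrite std_sum; apply: std0 => // m.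
  by rewrite -std_sum msupp_mrestr => /andP[].
- move=> f f_deg; have [g Jfg g_std] := normal_form_exists ord f idJ.
  pose in_a := fun m => deg (expv m) == a.
  have in_a_coset u v : same_coset c u v -> in_a u = in_a v.
    by move=> [k /same_coset_degree]; rewrite /in_a deg_c scaler0 addr0 => ->.
  pose g' := mrestr in_a g.
  have Jfg' : J (f - g').
    have -> : f - g' = mrestr in_a (f - g).
      rewrite raddfB; congr (_ - _); apply/mpolyP => m; rewrite mcoeff_mrestr.
      case: ifP => // /negbT m_a; apply: memN_msupp_eq0.
      by apply: contra m_a => /f_deg/eqP.
    exact: gradJ.
  have g'_deg : graded_piece deg a g'.
    by move=> u; rewrite msupp_mrestr => /andP[/eqP].
  have [x /M_std gx] := b_span g' g'_deg; exists x.
  move: gx; rewrite raddfB => /subr0_eq /=; rewrite std_sum => <-.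
  suff <- : g' = mrestr std g' by [].
  apply/mpolyP => m; rewrite [RHS]mcoeff_mrestr;
    case: stdP => // /boolp.contrapT lead_m.
  apply: memN_msupp_eq0; rewrite msupp_mrestr negb_and; apply/orP; right.
  by apply/negP => /g_std.
Qed.

(** By Dickson's lemma, this amounts to the degrees of monomials being bounded
    below on every line a + Z (deg c). *)
Definition bounded_below c : Prop :=
  forall u k, (0 < k)%N -> deg (expv u) <> - (deg c *+ k).

(** Monomials whose degrees are a negative and a positive multiple of deg c have
    a product of powers of degree 0, which positivity rules out. *)
Lemma bounded_below_or c : deg c != 0 -> bounded_below c \/ bounded_below (- c).
Proof.
move=> deg_c; apply: boolp.contrapT => /boolp.not_orP[no1 no2].
apply: no1 => u k k0 deg_u; apply: no2 => v l l0.
rewrite raddfN mulNrn opprK => deg_v.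
have /deg_pos/eqP : deg (expv (u *+ l + v *+ k)%MM) = 0.
  rewrite expvD !expvMn raddfD !raddfMn /= deg_u deg_v mulNrn -!mulrnA mulnC.
  by rewrite addrC subrr.
rewrite mnmD_eq0 => /andP[/eqP u0 _].
have /eqP u00 : u == 0%MM.
  apply/eqP/mnmP => i; move/mnmP/(_ i): u0; rewrite mulmnE mnm0E => /eqP.
  by rewrite muln_eq0 (gtn_eqF l0) orbF => /eqP.
move: deg_u; rewrite u00 expv0 raddf0 => /esym/eqP; rewrite oppr_eq0 => /eqP.
by move/(rowMn_eq0 k0) => /eqP; rewrite (negPf deg_c).
Qed.

(** Let b be a monomial of lowest degree on its line among those that are
    initial for exactly one of the orders.  A monomial m of degree deg b that is
    initial for le1 is the leading term of an element of J supported on m and on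
    monomials m - k c with k > 0 that are standard for le1, hence by minimality
    also for le2.  This element has an initial monomial for le2, so that
    monomial is m.  Thus M1 is contained in M2 in degree deg b, and equality of
    dimensions contradicts the choice of b. *)
Lemma hilbert_rigid J M1 M2 c le1 le2 (h : 'rV[int]_q -> nat) :
  is_ideal J -> coset_graded c J -> term_order le1 -> term_order le2 ->
  nonneg_in le1 c -> deg c != 0 -> bounded_below c ->
  (forall f, M1 f <-> forall m, m \in msupp f -> lead_mnm le1 J m) ->
  (forall f, M2 f <-> forall m, m \in msupp f -> lead_mnm le2 J m) ->
  (forall a, quotient_dim (@graded_piece K n q deg a) M1 (h a)) ->
  (forall a, quotient_dim (@graded_piece K n q deg a) M2 (h a)) ->
  same_lead J le1 le2.
Proof.
move=> idJ gradJ ord1 ord2 pos_c deg_c below M1P M2P dim1 dim2.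
have subM M le : (forall f, M f <-> forall m, m \in msupp f ->
  lead_mnm le J m) ->
    submodule M.
  move=> MP; split=> [|f g /MP fl /MP gl|x f /MP fl]; apply/MP => m.
  - by rewrite mcoeff_msupp mcoeff0 eqxx.
  - by move/msuppD_le; rewrite mem_cat => /orP[/fl|/gl].
  - by move/msuppZ_le/fl.
pose bad m := ~ (lead_mnm le1 J m <-> lead_mnm le2 J m).
apply: boolp.contrapT => /boolp.existsNP[m0 bad_m0].
pose below_m0 m := bad m /\ exists k, deg (expv m0) = deg (expv m) + deg c *+ k.
have m0_below : below_m0 m0 by split=> //; exists 0%N; rewrite mulr0n addr0.
(* Dickson's lemma replaces the finiteness of the fibres of deg: a lowest
   element of the basis is lowest overall. *)
have [B [BS Ble]] := dickson_mnm below_m0.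
have [||x y xB yB|b bB b_min] :=
  @seq_min _ (fun x y => exists k, deg (expv y) = deg (expv x) + deg c *+ k) B.
- by have [b bB _] := Ble _ m0_below; case: (B) bB.
- move=> x y z [k xy] [l yz]; exists (k + l)%N.
  by rewrite yz xy mulrnDr addrA.
- have [_ [k xk]] := BS x xB; have [_ [l yl]] := BS y yB.
  move: yl; rewrite xk; case/orP: (leq_total k l) => [kl|lk] /eqP.
    rewrite -(subnK kl) mulrnDr addrA (inj_eq (addIr _)) => /eqP xy.
    by right; exists (l - k)%N.
  rewrite -(subnK lk) mulrnDr addrA (inj_eq (addIr _)) => /eqP xy.
  by left; exists (k - l)%N.
have [bad_b [k0 m0b]] := BS b bB.
have good m k : (0 < k)%N -> deg (expv b) = deg (expv m) + deg c *+ k ->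
    lead_mnm le1 J m <-> lead_mnm le2 J m.
  move=> k_gt0 bm; apply: boolp.contrapT => bad_m.
  (* A bad m below b gives m - b' of degree a negative multiple of deg c. *)
  have [|b' b'B b'm] := Ble m.
    by split=> //; exists (k + k0)%N; rewrite m0b bm mulrnDr addrA.
  have [l b'b] := b_min b' b'B.
  apply: (below (m - b')%MM (k + l)%N); first by rewrite addn_gt0 k_gt0.
  have bE : deg (expv (m - b')%MM) + (deg (expv b) + deg c *+ l) + deg c *+ k =
    deg (expv b).
    by rewrite -b'b -raddfD -expvD submK.
  apply/eqP; rewrite -addr_eq0 -(inj_eq (addrI (deg (expv b)))) addr0 -{2}bE.
  by rewrite mulrnDr addrCA -!addrA [deg c *+ l + _]addrC.
have sub12 m : deg (expv m) = deg (expv b) -> lead_mnm le1 J m ->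
  lead_mnm le2 J m.
  move=> mb lead_m; apply: boolp.contrapT => nlead_m.
  have [g Jr g_std] := normal_form_exists ord1 'X_[m] idJ.
  pose P u := boolp.asbool (same_coset c m u).
  have P_coset u v : same_coset c u v -> P u = P v.
    move=> uv; apply: boolp.asbool_equiv_eq; exact: same_coset_congr.
  have Pm : P m by apply/boolp.asboolP; exists 0; rewrite subrr scale0r.
  have r0 : mrestr P ('X_[m] - g) = 0.
    apply: (standard_eq0 ord2 (gradJ P P_coset _ Jr)) => u.
    rewrite msupp_mrestr => /andP[/boolp.asboolP[k muE] /msuppB_le].
    rewrite mem_cat => /orP[/mem_msuppXP <- //|ug].
    have := groebner_dual_nonneg ord1 (groebner_dual_tail lead_m Jr g_std ug).
    have nlead1_u := g_std u ug.
    rewrite muE; case: k muE => [[|k]|k] muE pos_k.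
    + move: muE; rewrite scale0r => /subr0_eq/expv_inj mu.
      by rewrite -mu.
    + have bu : deg (expv b) = deg (expv u) + deg c *+ k.+1.
        by rewrite -mb (same_coset_degree muE) -scaler_nat natz.
      by rewrite -(good u k.+1 isT bu).
    + have mu0 : k.+1%:Z *: c = 0.
        apply: (nonneg_in_anti ord1); last by rewrite -scaleNr -NegzE.
        by rewrite -natz scaler_nat; apply: nonneg_inMn.
      move: muE; rewrite NegzE scaleNr mu0 oppr0 => /subr0_eq/expv_inj mu.
      by rewrite -mu.
  have : (mrestr P ('X_[m] - g))@_m = 1.
    rewrite mcoeff_mrestr Pm mcoeffB mcoeffX eqxx memN_msupp_eq0 ?subr0 //.
    by apply/negP => /g_std.
  by rewrite r0 mcoeff0 => /eqP; rewrite eq_sym oner_eq0.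
have eq12 := quotient_dim_eq (graded_piece_submodule (deg (expv b)))
  (subM _ _ M1P) (subM _ _ M2P) _ (dim1 _) (dim2 _).
apply: bad_b; split; first exact: sub12.
move=> lead_b; suff /M1P : M1 'X_[b] by apply; rewrite msuppX inE.
apply: eq12.
- move=> f f_deg /M1P f_lead; apply/M2P => m mf.
  by apply: sub12; [apply: f_deg | apply: f_lead].
- by move=> u /mem_msuppXP <-.
- by apply/M2P => u /mem_msuppXP <-.
Qed.

End Grading.

(** * The induced subgraph property *)

Theorem theorem11 (K : fieldType) (n q : nat)
    (deg : {additive 'rV[int]_n -> 'rV[int]_q})
    (deg_surj : forall a : 'rV[int]_q, exists u : 'rV[int]_n, deg u = a)
    (deg_pos : positive_grading deg)
    (h : 'rV[int]_q -> nat)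
    (M1 M2 : psubset K n)
    (mon_M1 : monomial_ideal M1) (mon_M2 : monomial_ideal M2)
    (Hilb_M1 : in_Hilb deg h M1) (Hilb_M2 : in_Hilb deg h M2)
    (edge_M1_M2 : graph_edge M1 M2) :
  exists I : psubset K n,
    [/\ edge_ideal I, in_Hilb deg h I & initial_ideals_are I M1 M2].
Proof.
case: edge_M1_M2 => _ _ M12 [I idI inI].
have [le1 ord1 M1I] : exists2 le, term_order le & same_set M1 (initial_ideal le
  I).
  by apply/inI; left.
have [le2 ord2 M2I] : exists2 le, term_order le & same_set M2 (initial_ideal le
  I).
  by apply/inI; right.
have M1P := initial_ideal_lead ord1 idI M1I.
have M2P := initial_ideal_lead ord2 idI M2I.
have neq12 : ~ same_lead I le1 le2.
  by move=> same; apply: M12 => f; rewrite M1P M2P; split=> lf m /lf /same.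
have only12 : only_lead I le1 le2.
  move=> le ord; have [|inM|inM] := (inI (initial_ideal le I)).1;
    first by exists le.
    by left=> m; rewrite -!initial_idealX // inM M1I.
  by right=> m; rewrite -!initial_idealX // inM M2I.
have [J [c [[idJ gradJ homJ] [c_pos c_neg pos_c pos_Nc] lead1 lead2 lead]]] :=
  edge_ideal_exists idI ord1 ord2 only12 neq12.
have M1J f : M1 f <-> forall m, m \in msupp f -> lead_mnm le1 J m.
  by rewrite M1P; split=> lf m /lf /lead1.
have M2J f : M2 f <-> forall m, m \in msupp f -> lead_mnm le2 J m.
  by rewrite M2P; split=> lf m /lf /lead2.
have neqJ : ~ same_lead J le1 le2.
  by move=> same; apply: neq12 => m; rewrite -lead1 -lead2.
have deg_c : deg c = 0.
  apply/eqP/contraT => deg_c; case: neqJ.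
  have [below|below] := bounded_below_or deg_pos deg_c.
    exact: (hilbert_rigid idJ gradJ ord1 ord2 pos_c deg_c below M1J M2J
      Hilb_M1.2 Hilb_M2.2).
  (* Reversing c exchanges the roles of the two orders. *)
  have gradNJ : coset_graded (- c) J.
    move=> P Pc; apply: gradJ => u v [k uv]; apply: Pc; exists (- k).
    by rewrite scaleNr scalerN opprK.
  have deg_Nc : deg (- c) != 0 by rewrite raddfN oppr_eq0.
  move=> m; symmetry.
  exact: (hilbert_rigid idJ gradNJ ord2 ord1 pos_Nc deg_Nc below M2J M1J
    Hilb_M2.2 Hilb_M1.2).
exists J; split.
- by exists c.
- split=> [|a]; last exact: quotient_dim_initial ord1 idJ gradJ deg_c M1J
    (Hilb_M1.2 a).
  apply: homogeneous_idealW homJ => u v [k /same_coset_degree].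
  by move=> /(_ q deg); rewrite deg_c scaler0 addr0.
- move=> M; split=> [[le ord ML]|].
    have [le' ord' le'le] := lead le ord.
    apply/inI; exists le' => // f; rewrite ML.
    exact: lead_same_initial.
  case=> [MM|MM].
    exists le1 => // f; rewrite MM M1I.
    by apply: lead_same_initial => // m; rewrite lead1.
  exists le2 => // f; rewrite MM M2I.
  by apply: lead_same_initial => // m; rewrite lead2.
Qed.
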